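(* Let $d\ge1$, $P\ge1$, and let $A\in H_{2d}^+(\mathbb{C})$ satisfy Assumptions I and II. Let $X^{(P)}=(X_0,\dots,X_P)$ be the homogeneous $\mathbb{C}^d$-valued Gaussian Markov process of size $P$ with weight given by $A$ and eigen-boundary conditions $B_L$ and $B_R$. Then $X^{(P)}$ is a centered Gaussian vector with covariance matrix given by the block-Toeplitz matrix $$\Sigma^{(P)}=(C_{l-k})_{k,l\in\{1,\dots,P+1\}}.$$
   Context: $H_n^+(\mathbb{C})$ is the set of $n\times n$ complex Hermitian positive definite matrices. A matrix $A\in H_{2d}^+(\mathbb{C})$ is written in $d\times d$ blocks $A=\begin{pmatrix} A_{LL} & A_{LR} \\ A_{RL} & A_{RR} \end{pmatrix}$. Define $\Phi(z)=A_{LL}+A_{RR}+A_{LR}z+A_{RL}z^{-1}$ for $z\in\mathbb{C}^*$, $\mathcal{S}=\{z\in\mathbb{C}^*:\det\Phi(z)=0\}$, $\mathcal{S}_{<1}=\{w\in\mathcal{S}:|w|<1\}$, $\mathcal{S}_{>1}=\{w\in\mathcal{S}:|w|>1\}$. $\Phi(z)$ is Hermitian positive definite for $|z|=1$, and $C_k=\frac1{2\pi}\int_0^{2\pi}\Phi(e^{\mathrm{i}\theta})^{-1}e^{-\mathrm{i}k\theta}d\theta$ for $k\in\mathbb{Z}$. Assumption I: $\mathrm{rank}(A_{LR})=d$. Assumption II: every $w\in\mathcal{S}$ is a simple root of the polynomial $z^d\det\Phi(z)$ and $\dim\ker\Phi(w)=1$. For each $w\in\mathcal{S}$ fix $u_w\neq0$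 spanning $\ker\Phi(w)$. Under I and II, $(u_w)_{w\in\mathcal{S}_{<1}}$ and $(u_w)_{w\in\mathcal{S}_{>1}}$ are bases of $\mathbb{C}^d$; $W_{<1},W_{>1}\in M_d(\mathbb{C})$ are defined by $W_{<1}u_w=wu_w$ for $w\in\mathcal{S}_{<1}$ and $W_{>1}u_w=wu_w$ for $w\in\mathcal{S}_{>1}$. The eigen-boundary conditions are $B_L=A_{RR}+A_{RL}W_{>1}^{-1}\in H_d^+(\mathbb{C})$ and $B_R=A_{LL}+A_{LR}W_{<1}\in H_d^+(\mathbb{C})$. The process $X^{(P)}$ has density with respect to Lebesgue measure on $\mathbb{C}^{d(P+1)}$ proportional to $\exp(-\tfrac12x^*Qx)$, where $Q=Q^{(P)}_{(A,B_L,B_R)}$ is the Hermitian positive definite matrix defined by $$x^*Qx=x_0^*B_Lx_0+\sum_{k=0}^{P-1}\begin{pmatrix} x_k \\ x_{k+1} \end{pmatrix}^*A\begin{pmatrix} x_k \\ x_{k+1} \end{pmatrix}+x_P^*B_Rx_P,\quad x=(x_0,\dots,x_P).$$ Convention: a centered circularly symmetric complex Gaussian vector with density proportional to $\exp(-\tfrac12x^*Qx)$ is said to have covariance matrix $Q^{-1}$ (equivalently, characteristic function $\mathbb{E}[\exp(\mathrm{i}\,\mathrm{Re}\,a^*X)]=\exp(-\tfrac12a^*Q^{-1}a)$); thus the covariance matrix is $\tfrac12\mathbb{E}[XX^*]$. *)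

(* Defs.v *)
From HB Require Import structures.
From mathcomp Require Import all_boot all_order all_algebra.
From mathcomp Require Import complex.
From mathcomp Require Import all_classical all_reals all_analysis.

Set Implicit Arguments.
Unset Strict Implicit.
Unset Printing Implicit Defensive.

Import Order.TTheory GRing.Theory Num.Theory.
Import numFieldNormedType.Exports.

Local Open Scope classical_set_scope.
Local Open Scope ring_scope.
Local Open Scope sesquilinear_scope.
Local Open Scope complex_scope.

Section Matrices.
Variable R : realType.
Local Notation C := R[i].

Definition qform n (M : 'M[C]_n) (x : 'cV[C]_n) : C := (x^t* *m M *m x) 0 0.

(* In the order of R[i], 0 < z forces z to be real. *)
Definition hpdmx n (M : 'M[C]_n) : Prop :=
  M \is hermsymmx /\ forall x : 'cV[C]_n, x != 0 -> 0 < qform M x.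

Definition spans_ker n (M : 'M[C]_n) (u : 'cV[C]_n) : Prop :=
  u != 0 /\ forall v : 'cV[C]_n, M *m v = 0 <-> exists a : C, v = a *: u.

Variable d : nat.
Implicit Types A : 'M[C]_(d + d).

Definition A_LL A : 'M[C]_d := ulsubmx A.
Definition A_LR A : 'M[C]_d := ursubmx A.
Definition A_RL A : 'M[C]_d := dlsubmx A.
Definition A_RR A : 'M[C]_d := drsubmx A.

Definition Phi A (z : C) : 'M[C]_d :=
  A_LL A + A_RR A + z *: A_LR A + z^-1 *: A_RL A.

Definition spec A : set C := [set z | z != 0 /\ \det (Phi A z) = 0].
Definition spec_lt1 A : set C := [set w | spec A w /\ `|w| < 1].
Definition spec_gt1 A : set C := [set w | spec A w /\ 1 < `|w|].

(* The polynomial z^d det(Phi(z)) = det(z Phi(z)). *)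
Definition detPhi_poly A : {poly C} :=
  \det ('X *: map_mx polyC (A_LL A + A_RR A)
        + 'X^2 *: map_mx polyC (A_LR A) + map_mx polyC (A_RL A)).

Lemma detPhi_polyE A (z : C) : z != 0 ->
  (detPhi_poly A).[z] = z ^+ d * \det (Phi A z).
Proof.
move=> z0; rewrite /detPhi_poly -detZ -[LHS]/(horner_eval z _) -det_map_mx.
congr (\det _); apply/matrixP => i j.
rewrite !mxE /= horner_evalE !hornerE /= !mulrDr mulrA -expr2 mulrA divff// mul1r.
by [].
Qed.

Definition assumptionI A : Prop := \rank (A_LR A) = d.

(* kermx is the left kernel; the columns of cokermx M span {v | M v = 0}. *)
Definition assumptionII A : Prop := forall w, spec A w ->
  mup w (detPhi_poly A) = 1%N /\ \rank (cokermx (Phi A w)) = 1%N.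

Definition expi (t : R) : C := cos t +i* sin t.

Definition circle_mean (f : R -> C) : C :=
  ((2 * pi)^-1 * \int[lebesgue_measure]_(t in `[0, 2 * pi]) complex.Re (f t))
  +i* ((2 * pi)^-1 * \int[lebesgue_measure]_(t in `[0, 2 * pi]) complex.Im (f t)).

Definition coefC A (k : int) : 'M[C]_d :=
  \matrix_(i, j) circle_mean (fun t =>
    invmx (Phi A (expi t)) i j * expi (- (k%:~R * t))).

Definition bcL A (Wgt1 : 'M[C]_d) : 'M[C]_d := A_RR A + A_RL A *m invmx Wgt1.
Definition bcR A (Wlt1 : 'M[C]_d) : 'M[C]_d := A_LL A + A_LR A *m Wlt1.

Definition weight A (BL BR : 'M[C]_d) (P : nat) (x : 'I_P.+1 -> 'cV[C]_d) : C :=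
  qform BL (x ord0)
  + \sum_(k < P) qform A (col_mx (x (inord k)) (x (inord k.+1)))
  + qform BR (x ord_max).

Definition toeplitz_cov A (P : nat) : 'M[C]_(\sum_(k < P.+1) d) :=
  \mxblock_(k < P.+1, l < P.+1) coefC A (l%:Z - k%:Z).

End Matrices.

(* mu \x nu, renamed because the canonical sigma-finite structure found for
   \x is the one for subprobabilities. *)
Section SigmaFiniteProduct.
Context d1 d2 (T1 : measurableType d1) (T2 : measurableType d2) (R : realType).
Variable mu : {sigma_finite_measure set T1 -> \bar R}.
Variable nu : {sigma_finite_measure set T2 -> \bar R}.

Definition sf_prod : set (T1 * T2) -> \bar R := (mu \x nu)%E.

HB.instance Definition _ := Measure.on sf_prod.

Let sf_prod_sigma_finite : sigma_finite setT sf_prod.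
Proof.
have /sigma_finiteP[F [TF ndF Foo]] := sigma_finiteT mu.
have /sigma_finiteP[G [TG ndG Goo]] := sigma_finiteT nu.
exists (fun n => F n `*` G n).
  rewrite -setXTT TF TG predeqE => -[x y]; split.
    move=> [/= [n _ Fnx] [k _ Gky]]; exists (maxn n k) => //; split.
    - by move: x Fnx; exact/subsetPset/ndF/leq_maxl.
    - by move: y Gky; exact/subsetPset/ndG/leq_maxr.
  by move=> [n _ []/= ? ?]; split; exists n.
move=> k; have [? ?] := Foo k; have [? ?] := Goo k.
split; first exact: measurableX.
by rewrite /sf_prod product_measure1E// lte_mul_pinfty// ge0_fin_numE.
Qed.

HB.instance Definition _ :=
  Measure_isSigmaFinite.Build _ _ _ sf_prod sf_prod_sigma_finite.

End SigmaFiniteProduct.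

(* The n-fold product of a sigma-finite measure, on n.-tuple T. *)
Section TuplePower.
Context dT (T : measurableType dT) (R : realType).
Variable mu : {sigma_finite_measure set T -> \bar R}.

Definition mcons n (p : T * n.-tuple T) : n.+1.-tuple T :=
  [tuple of p.1 :: p.2].

Lemma measurable_mcons n : measurable_fun [set: T * n.-tuple T] (@mcons n).
Proof. exact: measurable_cons. Qed.

HB.instance Definition _ n :=
  isMeasurableFun.Build _ _ _ _ (@mcons n) (@measurable_mcons n).

Section Step.
Variables (n : nat) (nu : {sigma_finite_measure set (n.-tuple T) -> \bar R}).

Definition tpower_step : set (n.+1.-tuple T) -> \bar R :=
  pushforward (sf_prod mu nu) (@mcons n).

Let tpower_step0 : tpower_step set0 = 0%E.
Proof. exact: measure0. Qed.

Let tpower_step_ge0 B : (0 <= tpower_step B)%E.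
Proof. exact: measure_ge0. Qed.

Let tpower_step_sigma_additive : semi_sigma_additive tpower_step.
Proof. exact: measure_semi_sigma_additive. Qed.

HB.instance Definition _ := isMeasure.Build _ _ _ tpower_step
  tpower_step0 tpower_step_ge0 tpower_step_sigma_additive.

Let tpower_step_sigma_finite : sigma_finite setT tpower_step.
Proof.
have /sigma_finiteP[F [TF ndF Foo]] :=
  sigma_finiteT (sf_prod mu nu).
pose g (t : n.+1.-tuple T) : T * n.-tuple T := (thead t, [tuple of behead t]).
have gK : cancel (@mcons n) g.
  by case=> x t; congr pair; apply/val_inj.
have Kg : cancel g (@mcons n).
  by move=> t; rewrite [RHS]tuple_eta; apply/val_inj.
exists (fun k => g @^-1` F k).
  by rewrite -preimage_bigcup -TF preimage_setT.
move=> k; have [mF Fk] := Foo k; split.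
  rewrite -[X in measurable X]setTI; apply: (_ : measurable_fun setT g) => //.
  apply/measurable_fun_pairP; split; first exact: measurable_tnth.
  exact: measurable_behead.
rewrite /tpower_step /pushforward -comp_preimage.
by rewrite (_ : g \o _ = id)// funeqE => p /=; rewrite gK.
Qed.

HB.instance Definition _ :=
  Measure_isSigmaFinite.Build _ _ _ tpower_step tpower_step_sigma_finite.

End Step.

Fixpoint tpower (n : nat) : {sigma_finite_measure set (n.-tuple T) -> \bar R} :=
  if n is m.+1 then tpower_step (tpower m) else dirac [tuple].

End TuplePower.

Section Gaussian.
Variable R : realType.
Local Notation C := R[i].

(* C^d and (C^d)^(P+1), with C identified with R * R. *)
Definition Cspace := (measurableTypeR R * measurableTypeR R)%type.
Definition Cvec (d : nat) := d.-tuple Cspace.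
Definition Cpath (P d : nat) := P.+1.-tuple (Cvec d).

Definition lebesgueC : {sigma_finite_measure set Cspace -> \bar R} :=
  sf_prod (@lebesgue_measure R) (@lebesgue_measure R).
Definition lebesgue_path P d : {sigma_finite_measure set (Cpath P d) -> \bar R} :=
  tpower (tpower lebesgueC d) P.+1.

Definition colvec d (v : Cvec d) : 'cV[C]_d :=
  \col_i ((tnth v i).1 +i* (tnth v i).2).
Definition site P d (x : Cpath P d) (k : 'I_P.+1) : 'cV[C]_d :=
  colvec (tnth x k).
Definition stack P d (x : Cpath P d) : 'cV[C]_(\sum_(k < P.+1) d) :=
  \mxcol_(k < P.+1) site x k.

Section Law.
Context dO (Omega : measurableType dO) (Pr : probability Omega R) (P d : nat).
Variable X : {RV Pr >-> Cpath P d}.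

(* X has a density proportional to exp(- q(x) / 2); q takes real values for
   the forms used here. *)
Definition density_exp_half (q : Cpath P d -> C) : Prop :=
  exists2 c : R, 0 < c & forall B : set (Cpath P d), measurable B ->
    distribution Pr X B =
    (\int[lebesgue_path P d]_(x in B)
       (c * expR (- 2^-1 * complex.Re (q x)))%:E)%E.

Definition gaussian_markov_process (A : 'M[C]_(d + d)) (BL BR : 'M[C]_d) : Prop :=
  density_exp_half (fun x => weight A BL BR (site x)).

(* A density proportional to exp(- x^* Q x / 2) gives covariance Q^-1: the
   covariance matrix is E[X X^*] / 2 and not E[X X^*]. *)
Definition centered_gaussian (Sigma : 'M[C]_(\sum_(k < P.+1) d)) : Prop :=
  exists Q : 'M[C]_(\sum_(k < P.+1) d),
    [/\ hpdmx Q, Sigma = invmx Q & density_exp_half (fun x => qform Q (stack x))].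

End Law.
End Gaussian.

(* Main.v *)
(** Write C_k for the Fourier coefficients of the inverse of Phi on the unit
    circle.  Put N(z) = z Phi(z).  Its determinant has degree 2d and simple
    nonzero roots, so Lagrange interpolation of the adjugate of N decomposes
    Phi(z)^-1 as the sum of the terms z R_w / (z - w) over the spectrum, where
    Phi(w) R_w = 0 and hence W R_w = w R_w for the matrix W attached to the
    side of the circle where w lies.  Interpolating z adj N(z) instead gives
    the same sum with w R_w / (z - w).  Since the Fourier coefficients of
    1 / (z - w) vanish on one half-line, comparing the two sums yields
    W_{>1} C_{k+1} = C_k for k >= 0 and W_{<1} C_k = C_{k-1} for k <= 0.
    Together with the three-term recurrence coming from Phi Phi^-1 = 1, this
    shows that the block tridiagonal matrix Q of the weight is the inverse of
    the block Toeplitz matrix.  The latter is positive definite because its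
    quadratic form is the mean over the circle of p^* Phi^-1 p for a
    trigonometric polynomial p; positivity of Q then follows without having to
    know that the boundary matrices are positive definite. *)
Require Import Defs.
From mathcomp Require Import all_boot all_order all_algebra.
From mathcomp Require Import ring zify.
From mathcomp Require Import perm complex.
From mathcomp Require Import all_classical all_reals all_analysis.

Local Open Scope classical_set_scope.
Local Open Scope ring_scope.
Local Open Scope complex_scope.

Set Implicit Arguments.
Unset Strict Implicit.
Unset Printing Implicit Defensive.
Import Order.TTheory GRing.Theory Num.Theory.
Import numFieldNormedType.Exports.

(** * Means over the unit circle and their Fourier orthogonality *)

Section CircleMean.
Variable R : realType.
Local Notation C := R[i].
Implicit Types (f g : R -> C) (a z : C) (t : R).

(* Coordinatewise, so that no topology on R[i] is involved. *)
Definition ccont f : Prop :=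
  continuous (fun t => complex.Re (f t)) /\ continuous (fun t => complex.Im (f t)).

Lemma ReD a z : complex.Re (a + z) = complex.Re a + complex.Re z.
Proof. by case: a z => [? ?] [? ?]. Qed.

Lemma ImD a z : complex.Im (a + z) = complex.Im a + complex.Im z.
Proof. by case: a z => [? ?] [? ?]. Qed.

Lemma ReM a z : complex.Re (a * z) =
  complex.Re a * complex.Re z - complex.Im a * complex.Im z.
Proof. by case: a z => [? ?] [? ?]. Qed.

Lemma ImM a z : complex.Im (a * z) =
  complex.Re a * complex.Im z + complex.Im a * complex.Re z.
Proof. by case: a z => [? ?] [? ?]. Qed.

Lemma ReV z : complex.Re z^-1 =
  complex.Re z / (complex.Re z ^+ 2 + complex.Im z ^+ 2).
Proof. by case: z. Qed.

Lemma ImV z : complex.Im z^-1 =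
  - (complex.Im z / (complex.Re z ^+ 2 + complex.Im z ^+ 2)).
Proof. by case: z. Qed.

Lemma complex_eq a z :
  complex.Re a = complex.Re z -> complex.Im a = complex.Im z -> a = z.
Proof. by case: a z => [? ?] [? ?] /= -> ->. Qed.

Lemma sqr_Re_Im_neq0 z : z != 0 -> complex.Re z ^+ 2 + complex.Im z ^+ 2 != 0.
Proof.
case: z => x y; apply: contra => /=.
by rewrite paddr_eq0 ?sqr_ge0// !sqrf_eq0 => /andP[/eqP-> /eqP->].
Qed.

Lemma ccont_cst z : ccont (fun=> z).
Proof. by split=> t; exact: cvg_cst. Qed.

Lemma ccontD f g : ccont f -> ccont g -> ccont (fun t => f t + g t).
Proof.
move=> [f1 f2] [g1 g2]; split.
  under eq_fun do rewrite ReD; move=> t; exact: cvgD (f1 t) (g1 t).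
under eq_fun do rewrite ImD; move=> t; exact: cvgD (f2 t) (g2 t).
Qed.

Lemma ccontM f g : ccont f -> ccont g -> ccont (fun t => f t * g t).
Proof.
move=> [f1 f2] [g1 g2]; split.
  under eq_fun do rewrite ReM; move=> t.
  exact: cvgB (cvgM (f1 t) (g1 t)) (cvgM (f2 t) (g2 t)).
under eq_fun do rewrite ImM; move=> t.
exact: cvgD (cvgM (f1 t) (g2 t)) (cvgM (f2 t) (g1 t)).
Qed.

Lemma ccontV f : (forall t, f t != 0) -> ccont f -> ccont (fun t => (f t)^-1).
Proof.
move=> f0 [f1 f2].
have fn : continuous (fun t => complex.Re (f t) ^+ 2 + complex.Im (f t) ^+ 2).
  under eq_fun do rewrite !expr2.
  by move=> t; exact: cvgD (cvgM (f1 t) (f1 t)) (cvgM (f2 t) (f2 t)).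
have fV : continuous (fun t => (complex.Re (f t) ^+ 2 + complex.Im (f t) ^+ 2)^-1).
  by move=> t; apply: cvgV; [exact: sqr_Re_Im_neq0 | exact: fn].
split.
  under eq_fun do rewrite ReV; move=> t; exact: cvgM (f1 t) (fV t).
under eq_fun do rewrite ImV; move=> t; apply: cvgN; exact: cvgM (f2 t) (fV t).
Qed.

Lemma ccont_sum (I : Type) (r : seq I) (P : pred I) (F : I -> R -> C) :
  (forall i, P i -> ccont (F i)) -> ccont (fun t => \sum_(i <- r | P i) F i t).
Proof.
move=> cF; elim: r => [|i r IH].
  by under eq_fun do rewrite big_nil; exact: ccont_cst.
case Pi: (P i); under eq_fun do rewrite big_cons Pi; last exact: IH.
by apply: ccontD => //; exact: cF.
Qed.

Lemma ccont_conj f : ccont f -> ccont (fun t => (f t)^*%C).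
Proof.
have ReJ z : complex.Re z^*%C = complex.Re z by case: z.
have ImJ z : complex.Im z^*%C = - complex.Im z by case: z.
move=> [f1 f2]; split.
  by under eq_fun do rewrite ReJ.
under eq_fun do rewrite ImJ; move=> t; exact: cvgN (f2 t).
Qed.

Lemma ccont_expi (a : R) : ccont (fun t => expi (a * t)).
Proof.
have ca : continuous (fun t : R => a * t) by move=> t; exact: mulrl_continuous.
split=> t /=.
- by apply: continuous_comp; [exact: ca | exact: continuous_cos].
- by apply: continuous_comp; [exact: ca | exact: continuous_sin].
Qed.

Lemma expi0 : expi 0 = 1 :> C.
Proof. by rewrite /expi cos0 sin0. Qed.

Lemma expiD (s t : R) : expi (s + t) = expi s * expi t.
Proof.
apply: complex_eq; rewrite ?ReM ?ImM /=; first by rewrite cosD.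
by rewrite sinD addrC.
Qed.

Lemma expiNK t : expi t * expi (- t) = 1.
Proof. by rewrite -expiD subrr expi0. Qed.

Lemma expi_neq0 t : expi t != 0.
Proof.
by apply: contra_eq_neq (expiNK t) => ->; rewrite mul0r eq_sym oner_eq0.
Qed.

Lemma expiN t : expi (- t) = (expi t)^-1.
Proof. by apply: (mulfI (expi_neq0 t)); rewrite expiNK divff ?expi_neq0. Qed.

Lemma expi_conj t : (expi t)^*%C = expi (- t).
Proof. by rewrite /expi cosN sinN. Qed.

Lemma norm_expi t : `|expi t| = 1.
Proof. by rewrite normc_def /= cos2Dsin2 sqrtr1. Qed.

Lemma expi_natmul2pi (n : nat) : expi (2 * pi *+ n) = 1 :> C.
Proof.
elim: n => [|n IH]; first by rewrite mulr0n expi0.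
by rewrite mulrSr expiD IH mul1r mulr_natl /expi cos2pi sin2pi.
Qed.

Lemma expi_int2pi (k : int) : expi (k%:~R * (2 * pi)) = 1 :> C.
Proof.
case: k => n; first by rewrite -pmulrn [n%:R * _]mulr_natl expi_natmul2pi.
by rewrite NegzE mulrNz mulNr expiN -pmulrn [n.+1%:R * _]mulr_natl expi_natmul2pi invr1.
Qed.

Local Notation D := `[0, 2 * pi]%classic.
Local Notation leb := (@lebesgue_measure R).

Lemma continuous_integrable (h : R -> R) : continuous h ->
  leb.-integrable D (EFin \o h).
Proof.
move=> ch; apply: continuous_compact_integrable; first exact: segment_compact.
exact: continuous_subspaceT.
Qed.

Lemma measD : measurable (D : set (measurableTypeR R)).
Proof. exact: measurable_itv. Qed.

Lemma circle_meanD f g : ccont f -> ccont g ->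
  circle_mean (fun t => f t + g t) = circle_mean f + circle_mean g.
Proof.
move=> [f1 f2] [g1 g2]; apply: complex_eq => /=; rewrite -mulrDr; congr (_ * _).
  under eq_Rintegral do rewrite ReD.
  by rewrite RintegralD//; exact: continuous_integrable.
under eq_Rintegral do rewrite ImD.
by rewrite RintegralD//; exact: continuous_integrable.
Qed.

Lemma circle_meanZ a f : ccont f ->
  circle_mean (fun t => a * f t) = a * circle_mean f.
Proof.
move=> [f1 f2].
have cl (b : R) (h : R -> R) : continuous h -> leb.-integrable D (EFin \o (fun t => b * h t)).
  by move=> ch; apply: continuous_integrable => t; apply: cvgMr; exact: ch.
have i1 := continuous_integrable f1.
have i2 := continuous_integrable f2.
apply: complex_eq; rewrite ?ReM ?ImM /=.
  under eq_Rintegral do rewrite ReM.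
  rewrite RintegralB ?RintegralZl//; try exact: cl.
  by rewrite mulrBr !(mulrCA _ (complex.Re a)) !(mulrCA _ (complex.Im a)).
under eq_Rintegral do rewrite ImM.
rewrite RintegralD ?RintegralZl//; try exact: cl.
by rewrite mulrDr !(mulrCA _ (complex.Re a)) !(mulrCA _ (complex.Im a)).
Qed.

Lemma eq_circle_mean f g : f =1 g -> circle_mean f = circle_mean g.
Proof. by move=> /funext ->. Qed.

Lemma circle_mean0 : circle_mean (fun=> 0 : C) = 0.
Proof. 
rewrite (eq_circle_mean (g := fun=> 0 * 0)) => [|t]; last by rewrite mul0r.
by rewrite circle_meanZ ?mul0r//; exact: ccont_cst.
Qed.

Lemma circle_mean_sum (I : Type) (r : seq I) (P : pred I) (F : I -> R -> C) :
  (forall i, P i -> ccont (F i)) ->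
  circle_mean (fun t => \sum_(i <- r | P i) F i t) =
  \sum_(i <- r | P i) circle_mean (F i).
Proof.
move=> cF; elim: r => [|i r IH].
  rewrite big_nil -[RHS]circle_mean0.
  by apply: eq_circle_mean => t; rewrite big_nil.
rewrite big_cons -IH; case: ifP => Pi.
  rewrite -circle_meanD; [|exact: cF|exact: ccont_sum].
  by apply: eq_circle_mean => t; rewrite big_cons Pi.
by apply: eq_circle_mean => t; rewrite big_cons Pi.
Qed.

Lemma circle_mean_conj f : ccont f ->
  circle_mean (fun t => (f t)^*%C) = (circle_mean f)^*%C.
Proof.
have ReJ z : complex.Re z^*%C = complex.Re z by case: z.
have ImJ z : complex.Im z^*%C = -1 * complex.Im z by case: z => x y; rewrite mulN1r.
move=> [f1 f2]; apply: complex_eq; rewrite ?ReJ ?ImJ /=.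
  by under eq_Rintegral do rewrite ReJ.
under eq_Rintegral do rewrite ImJ.
by rewrite RintegralZl ?mulrN ?mulN1r ?mulrN//; exact: continuous_integrable.
Qed.

Lemma twopi_gt0 : 0 < 2 * pi :> R.
Proof. by rewrite mulr_gt0// pi_gt0. Qed.

Lemma fine_lebD : fine (leb D) = 2 * pi.
Proof. by rewrite lebesgue_measure_itv/= lte_fin twopi_gt0 /= subr0. Qed.

Lemma circle_mean_expi0 : circle_mean (fun=> 1 : C) = 1.
Proof.
apply: complex_eq => /=; rewrite Rintegral_cst// fine_lebD.
  by rewrite mul1r mulVf// gt_eqF// twopi_gt0.
by rewrite mul0r mulr0.
Qed.

Lemma Rintegral_FTC2 (h H : R -> R) : continuous h ->
  (forall t, is_derive t 1 H (h t)) ->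
  \int[leb]_(t in D) h t = H (2 * pi) - H 0.
Proof.
move=> ch dH.
have cH t : {for t, continuous H}.
  by apply/differentiable_continuous/derivable1_diffP; case: (dH t).
rewrite /Rintegral (continuous_FTC2 (F := H) twopi_gt0)//.
- exact: continuous_subspaceT.
- split; first by move=> t _; case: (dH t).
  + exact: cvg_at_right_filter (cH 0).
  + exact: cvg_at_left_filter (cH _).
- by move=> t _; rewrite derive1E; case: (dH t).
Qed.

(** Both coordinates have explicit primitives, sin(kt)/k and -cos(kt)/k, which take equal values at
    0 and 2 pi because k is an integer. *)
Lemma circle_mean_expi (k : int) : k != 0 ->
  circle_mean (fun t => expi (k%:~R * t)) = 0 :> C.
Proof.
move=> k0; pose c : R := k%:~R.
have c0 : c != 0 by rewrite intr_eq0.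
have [cc cs] := ccont_expi c.
have dl t : is_derive t 1 ( *%R c) c.
  by apply: is_derive_eq; rewrite /GRing.scale/= mulr1.
have dsin t : is_derive t 1 (fun t => c^-1 * sin (c * t)) (cos (c * t)).
  have := is_deriveZ c^-1 (is_derive1_comp (is_derive_sin (c * t)) (dl t)).
  by move/is_derive_eq; apply; rewrite /GRing.scale/= mulrCA mulVf ?mulr1.
have dcos t : is_derive t 1 (fun t => - c^-1 * cos (c * t)) (sin (c * t)).
  have := is_deriveZ (- c^-1) (is_derive1_comp (is_derive_cos (c * t)) (dl t)).
  move/is_derive_eq; apply.
  by rewrite /GRing.scale/= !mulNr mulrN opprK mulrCA mulVf ?mulr1.
have := expi_int2pi k; rewrite -/c /expi => -[cos2k sin2k].
apply: complex_eq => /=.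
  by rewrite (Rintegral_FTC2 cc dsin) sin2k !mulr0 sin0 !mulr0 subrr mulr0.
by rewrite (Rintegral_FTC2 cs dcos) cos2k mulr0 cos0 subrr mulr0.
Qed.

(** Real and imaginary parts are each bounded by B, whence the factor 2. This crude constant is
    enough for the geometric decay argument below. *)
Lemma circle_mean_bound f (B : R) : ccont f ->
  (forall t, `|f t| <= B%:C) -> `|circle_mean f| <= (2 * B)%:C.
Proof.
move=> [f1 f2] fB.
have JB (h : R -> R) : continuous h -> (forall t, `|h t| <= B) ->
    `|(2 * pi)^-1 * \int[leb]_(t in D) h t| <= B.
  move=> ch hB; rewrite normrM gtr0_norm ?invr_gt0 ?twopi_gt0//.
  rewrite mulrC ler_pdivrMr ?twopi_gt0//.
  apply: le_trans (le_normr_Rintegral _ (continuous_integrable ch)) _ => //.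
  have -> : B * (2 * pi) = \int[leb]_(_ in D) B by rewrite Rintegral_cst// fine_lebD.
  apply: le_Rintegral => //.
  + by apply: continuous_integrable => t; apply: cvg_norm; exact: ch.
  + by apply: continuous_integrable => t; exact: cvg_cst.
have normRe z : `|complex.Re z|%:C <= `|z| := normc_ge_Re z.
(* Multiplying by i turns the imaginary part into minus a real part, so the bound on real parts
   applies. *)
have normIm z : `|complex.Im z|%:C <= `|z|.
  have := normc_ge_Re (z * 'i%C); rewrite ReiNIm normrN normrM.
  by rewrite [`|'i%C|]normc_def /= expr0n expr1n add0r sqrtr1 mulr1.
have [x y]: `|complex.Re (circle_mean f)| <= B /\ `|complex.Im (circle_mean f)| <= B.
  by split; apply: JB => // t; rewrite -lecR; exact: le_trans (fB t).
case: (circle_mean f) x y => x y /= xB yB.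
have -> : x +i* y = x%:C + 'i%C * y%:C by rewrite [LHS]complexE.
apply: le_trans (ler_normD _ _) _; rewrite normrM.
rewrite [`|'i%C|]normc_def /= expr0n expr1n add0r sqrtr1 mul1r.
rewrite !normc_def /= !expr0n !addr0 !sqrtr_sqr -rmorphD lecR mulr_natl mulr2n.
exact: lerD.
Qed.

Lemma circle_mean_ge0 f : (forall t, 0 <= f t) -> 0 <= circle_mean f.
Proof.
move=> f0; rewrite lecE /=; apply/andP; split.
  under eq_Rintegral do rewrite (ger0_Im (f0 _)).
  by rewrite Rintegral_cst// mul0r mulr0.
rewrite mulr_ge0 ?invr_ge0 ?(ltW twopi_gt0)// Rintegral_ge0// => t _.
by have := f0 t; rewrite lecE => /andP[].
Qed.

(** Serves the strict positivity of the Toeplitz form: vanishing almost everywhere passes from [f]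
    to [g], so a zero mean need not be turned into pointwise vanishing of [f]. *)
Lemma circle_mean_eq0_support f g : ccont f -> ccont g ->
  (forall t, 0 <= f t) -> circle_mean f = 0 ->
  (forall t, f t = 0 -> g t = 0) -> circle_mean g = 0.
Proof.
move=> [f1 f2] [g1 g2] f_ge0 f0 fg.
have If t : complex.Im (f t) = 0 by exact: ger0_Im.
have Rf t : 0 <= complex.Re (f t) by have := f_ge0 t; rewrite lecE => /andP[].
have J0 : \int[leb]_(t in D) complex.Re (f t) = 0.
  case: f0 => /eqP; rewrite mulf_eq0 invr_eq0 gt_eqF ?twopi_gt0//=.
  by move=> /eqP.
(* f vanishes almost everywhere, hence so does g. *)
have ae0 : ae_eq leb D (EFin \o (fun t => complex.Re (f t))) (cst 0%E).
  apply/ae_eq_integral_abs => //.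
    exact: measurable_int (continuous_integrable f1).
  have fin := integrable_fin_num measD (continuous_integrable f1).
  under eq_integral => t _ do rewrite /= ger0_norm//.
  by rewrite -(fineK fin) [fine _]J0.
have aeg (h : C -> R) : h 0 = 0 -> continuous (fun t => h (g t)) ->
    \int[leb]_(t in D) h (g t) = 0.
  move=> h0 ch; rewrite /Rintegral (ae_eq_integral (cst 0%E))//.
  - by rewrite integral0.
  - exact: measurable_int (continuous_integrable ch).
  - apply: filterS ae0 => t /= ae Dt; have [ft] := ae Dt.
    by rewrite fg ?h0//; apply: complex_eq.
apply: complex_eq => /=; rewrite aeg ?mulr0//.
Qed.

End CircleMean.

(** * Top coefficients of determinants and partial fractions *)

Section PolyMatrix.

(** Size bounds replace exact degrees, so leading coefficients may vanish. In the coefficient of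
    index m + n, every product but one has a factor beyond its bound. *)
Lemma coefM_top (K : nzRingType) (p q : {poly K}) (m n : nat) :
  (size p <= m.+1)%N -> (size q <= n.+1)%N ->
  (size (p * q)%R <= (m + n).+1)%N /\ (p * q)`_(m + n) = p`_m * q`_n.
Proof.
move=> sp sq; split.
  apply: leq_trans (size_polyMleq _ _) _.
  by rewrite -subn1 leq_subLR add1n -addSn -addnS leq_add.
have mn : (m < (m + n).+1)%N by rewrite ltnS leq_addr.
rewrite coefM (bigD1 (Ordinal mn)) //= addKn big1 ?addr0// => i.
rewrite -val_eqE /= neq_ltn => /orP[im|mi].
  rewrite [q`__]nth_default ?mulr0//; apply: leq_trans sq _.
  by rewrite ltn_subRL ltn_add2r.
by rewrite [p`__]nth_default ?mul0r//; exact: leq_trans sp mi.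
Qed.

Lemma coef_prod_top (K : nzRingType) (m n : nat) (p : 'I_n -> {poly K}) :
  (forall i, size (p i) <= m.+1)%N ->
  (size (\prod_i p i)%R <= (m * n).+1)%N /\
  (\prod_i p i)`_(m * n) = \prod_i (p i)`_m.
Proof.
elim: n p => [|n IH] p sp.
  by rewrite !big_ord0 muln0 size_poly1 coef1.
rewrite !big_ord_recl mulnS; have [s1 c1] := IH (fun i => p (lift ord0 i)) (fun i => sp _).
by have [s2 ->] := coefM_top (sp ord0) s1; rewrite c1.
Qed.

(** Each term of the Leibniz expansion is a signed product of n entries, so [coef_prod_top] applies
    termwise. *)
Lemma coef_det_top (K : comNzRingType) (m n : nat) (M : 'M[{poly K}]_n) :
  (forall i j, size (M i j) <= m.+1)%N ->
  (size (\det M) <= (m * n).+1)%N /\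
  (\det M)`_(m * n) = \det (map_mx (coefp m) M).
Proof.
move=> sM; have top (s : {perm 'I_n}) := coef_prod_top (fun i => sM i (s i)).
split.
  apply: leq_trans (size_sum _ _ _) _; apply/bigmax_leqP => s _.
  by case: (s : bool); rewrite ?expr0 ?mul1r// ?expr1 ?mulN1r ?size_polyN; case: (top s).
rewrite /determinant coef_sum; apply: eq_bigr => s _.
transitivity ((-1) ^+ s * (\prod_i M i (s i))`_(m * n)).
  by case: (s : bool); rewrite ?expr0 ?mul1r// ?expr1 ?mulN1r ?coefN.
by have [_ ->] := top s; congr (_ * _); apply: eq_bigr => i _; rewrite mxE.
Qed.

(** Lagrange interpolation at the distinct points of [r]: the product over v != w, divided by the
    full product, leaves 1 / (z - w). *)
Lemma partial_fractions (K : fieldType) (r : seq K) (p : {poly K}) (z : K) :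
  uniq r -> (size p <= size r)%N -> z \notin r ->
  p.[z] / \prod_(w <- r) (z - w) =
  \sum_(w <- r) p.[w] / \prod_(v <- r | v != w) (w - v) / (z - w).
Proof.
move=> ur sp zr.
pose L w := \prod_(v <- r | v != w) ('X - v%:P).
have hL w x : (L w).[x] = \prod_(v <- r | v != w) (x - v).
  by rewrite horner_prod; apply: eq_bigr => v _; rewrite hornerXsubC.
have L0 w x : x \in r -> x != w -> (L w).[x] = 0.
  move=> xr xw; rewrite hL; apply/eqP; rewrite prodf_seq_eq0; apply/hasP.
  by exists x; rewrite ?xw ?subrr ?eqxx.
have Lw w : w \in r -> (L w).[w] != 0.
  move=> wr; rewrite hL prodf_seq_neq0; apply/allP => v vr.
  by apply/implyP => vw; rewrite subr_eq0 eq_sym.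
(* The difference of the two sides has size at most [size r] and vanishes at every point of [r]. *)
have : p = \sum_(w <- r) (p.[w] / (L w).[w]) *: L w.
  apply/eqP; rewrite -subr_eq0; apply/eqP/(roots_geq_poly_eq0 (rs := r)) => //.
    apply/allP => x xr; rewrite /root hornerD hornerN horner_sum subr_eq0.
    rewrite (bigD1_seq x)//= hornerZ divfK ?Lw// big1_seq ?addr0// => w /andP[wx _].
    by rewrite hornerZ (L0 _ _ xr) ?mulr0// eq_sym.
  apply: leq_trans (size_polyD _ _) _; rewrite geq_max sp size_polyN /=.
  apply: leq_trans (size_sum _ _ _) _; rewrite big_seq; apply/bigmax_leqP_seq => w wr _.
  apply: leq_trans (size_scale_leq _ _) _.
  rewrite /L -big_filter size_prod_XsubC -rem_filter// size_rem// prednK//.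
  by case: (r) wr.
move=> {1}->; rewrite horner_sum mulr_suml; apply: eq_big_seq => w wr.
rewrite hornerZ -mulrA -[in RHS]hL; congr (_ * _).
rewrite (bigD1_seq w)//= hL.
have zw : z - w != 0 by rewrite subr_eq0; apply: contraNneq zr => ->.
rewrite invfM mulrCA divff ?mulr1//.
rewrite prodf_seq_neq0; apply/allP => v vr; apply/implyP => _.
by rewrite subr_eq0; apply: contraNneq zr => ->.
Qed.

End PolyMatrix.

(** * Partial fractions of the inverse of Phi *)

Section ResolventPoly.
Variables (R : realType) (d : nat).
Local Notation C := R[i].
Implicit Type A : 'M[C]_(d + d).

(** The polynomial matrix z Phi(z), chosen so that [detPhi_poly] is its determinant by
    conversion. *)
Definition zPhi A : 'M[{poly C}]_d :=
  'X *: map_mx polyC (A_LL A + A_RR A)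
        + 'X^2 *: map_mx polyC (A_LR A) + map_mx polyC (A_RL A).

Lemma map_zPhi A (z : C) : z != 0 ->
  map_mx (horner_eval z) (zPhi A) = z *: Phi A z.
Proof.
move=> z0; apply/matrixP => i j.
rewrite !mxE /= horner_evalE !hornerE /= !mulrDr mulrA -expr2 mulrA divff// mul1r.
by [].
Qed.

Lemma size_zPhi A i j : (size (zPhi A i j) <= 3)%N.
Proof.
rewrite !mxE; apply/leq_sizeP => -[|[|[|k]]]// _.
by rewrite !coefD coefXM coefXnM !coefC /= !addr0.
Qed.

(** Only the X^2 term reaches the coefficient of index 2 of an entry. When [A_LR A] is invertible,
    the degree is therefore exactly 2d. *)
Lemma detPhi_poly_top A :
  (size (detPhi_poly A) <= (2 * d).+1)%N /\ (detPhi_poly A)`_(2 * d) = \det (A_LR A).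
Proof.
have [s c] := coef_det_top (size_zPhi A); split; first exact: s.
rewrite [LHS]c; congr (\det _); apply/matrixP => i j.
by rewrite !mxE /= !coefD coefXM coefXnM !coefC /= add0r addr0.
Qed.

(** Excludes 0 as a root when [A_RL A] is invertible, so that every root lies in [spec A]. *)
Lemma detPhi_poly_horner0 A : (detPhi_poly A).[0] = \det (A_RL A).
Proof.
rewrite -[LHS]/(horner_eval 0 _) -det_map_mx; congr (\det _); apply/matrixP => i j.
by rewrite !mxE /= horner_evalE !hornerE /= expr0n /= !mul0r !add0r.
Qed.

(** A minor of order d - 1 has degree at most 2d - 2; the extra factor X keeps the degree below 2d,
    the number of interpolation nodes. *)
Lemma size_adj_zPhi A i j : (size (('X * \adj (zPhi A) i j)%R) <= 2 * d)%N.
Proof.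
have d_gt0 : (0 < d)%N by case: (d) i => [[]|].
apply: leq_trans (size_polyMleq _ _) _; rewrite size_polyX add2n /=.
pose M := row' j (col' i (zPhi A)).
have sM k l : (size (M k l) <= 3)%N by rewrite [M k l]mxE mxE; exact: size_zPhi.
have [s _] := coef_det_top sM.
rewrite mxE /cofactor -signr_odd; case: (odd _).
  by rewrite expr1 mulN1r size_polyN; apply: leq_ltn_trans s _; lia.
by rewrite expr0 mul1r; apply: leq_ltn_trans s _; lia.
Qed.

(** The matrix [Rs w] is adj N(w) / D'(w), where N is [zPhi A] and D its determinant. Interpolating
    z adj N absorbs the outer factor z, which is why w replaces it in the second sum. *)
Lemma invmx_Phi_fractions A :
  \det (A_LR A) != 0 -> \det (A_RL A) != 0 ->
  (forall w, spec A w -> mup w (detPhi_poly A) = 1%N) ->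
  exists (r : seq C) (Rs : C -> 'M[C]_d),
    (forall w, w \in r -> spec A w /\ Phi A w *m Rs w = 0) /\
    forall z, z != 0 -> \det (Phi A z) != 0 ->
      invmx (Phi A z) = \sum_(w <- r) (z / (z - w)) *: Rs w /\
      invmx (Phi A z) = \sum_(w <- r) (w / (z - w)) *: Rs w.
Proof.
move=> detLR detRL simple.
set D := detPhi_poly A; pose lc := lead_coef D.
have [sD cD] := detPhi_poly_top A; rewrite -/D in sD cD.
have sizeD : size D = (2 * d).+1.
  apply/anti_leq; rewrite sD ltnNge; apply: contra detLR => sD'.
  by rewrite -cD nth_default.
have D0 : D != 0 by rewrite -size_poly_eq0 sizeD.
have [r Dr] := closed_field_poly_normal D; rewrite -/lc in Dr.
have lc0 : lc != 0 by rewrite lead_coef_eq0.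
have Dz z : D.[z] = lc * \prod_(w <- r) (z - w).
  rewrite {1}Dr hornerZ horner_prod; congr (_ * _).
  by apply: eq_bigr => v _; rewrite hornerXsubC.
have rD w : (w \in r) = root D w.
  by rewrite Dr rootZ// root_prod_XsubC.
have size_r : size r = (2 * d)%N.
  by apply/succn_inj; rewrite -sizeD Dr size_scale// size_prod_XsubC.
have r_neq0 w : w \in r -> w != 0.
  by move=> wr; apply: contraTneq wr => ->; rewrite rD /root detPhi_poly_horner0.
have r_spec w : w \in r -> spec A w.
  move=> wr; have w0 := r_neq0 _ wr; split=> //.
  move: wr; rewrite rD /root detPhi_polyE// mulf_eq0 expf_eq0 (negPf w0) andbF /=.
  by move/eqP.
(* The number of occurrences of w in [r] is its multiplicity as a root of [D], which is 1. *)
have ur : uniq r.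
  apply/count_mem_uniq => w; case: (boolP (w \in r)) => wr /=; last exact/count_memPn.
  rewrite -(mu_prod_XsubC w r) -[RHS](simple _ (r_spec _ wr)) -/D Dr.
  by rewrite -mul_polyC mupMr// rootC.
(* At a root w, [lc * e w] is the derivative of [D]. *)
pose e w := \prod_(v <- r | v != w) (w - v).
pose adjN z := map_mx (horner_eval z) (\adj (zPhi A)).
pose Rs w := (lc * e w)^-1 *: adjN w.
exists r, Rs; split=> [w wr|z z0 dz].
  split; first exact: r_spec.
  have w0 := r_neq0 _ wr.
  rewrite /Rs -scalemxAr; apply/eqP; rewrite scaler_eq0; apply/orP; right.
  (* N(w) adj N(w) = D(w) I = 0, and N(w) = w Phi(w) with w nonzero. *)
  have : map_mx (horner_eval w) (zPhi A *m \adj (zPhi A)) = 0.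
    rewrite mul_mx_adj map_scalar_mx /=.
    suff -> : horner_eval w (\det (zPhi A)) = 0 by exact: raddf0.
    by apply/eqP; move: wr; rewrite rD.
  rewrite map_mxM map_zPhi// -scalemxAl => /eqP; rewrite scaler_eq0 (negPf w0) /=.
  exact.
have zr : z \notin r.
  by rewrite rD /root detPhi_polyE// mulf_neq0// expf_neq0.
have inv_adj : invmx (Phi A z) = (z / D.[z]) *: adjN z.
  have DE : D.[z] = \det (z *: Phi A z) by rewrite detPhi_polyE// detZ.
  have uP : Phi A z \in unitmx by rewrite unitmxE unitfE.
  suff PN : Phi A z *m ((z / D.[z]) *: adjN z) = 1%:M.
    by rewrite -[RHS]mul1mx -(mulVmx uP) -mulmxA PN mulmx1.
  have Dz0 : D.[z] != 0 by rewrite DE detZ mulf_neq0 ?expf_neq0.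
  rewrite /adjN map_mx_adj map_zPhi// mulrC -scalemxAr -scalerA scalemxAr.
  rewrite -scalemxAr scalemxAl mul_mx_adj -DE scale_scalar_mx mulVf//.
have entry i j : (invmx (Phi A z)) i j = z / D.[z] * (\adj (zPhi A) i j).[z].
  by rewrite inv_adj !mxE.
have szXadj i j : (size ('X * \adj (zPhi A) i j)%R <= size r)%N.
  by rewrite size_r size_adj_zPhi.
have szadj i j : (size (\adj (zPhi A) i j) <= size r)%N.
  apply: leq_trans (szXadj i j); have [->|p0] := eqVneq (\adj (zPhi A) i j) 0.
    by rewrite size_poly0.
  by rewrite mulrC size_mulX.
have fractions (p : {poly C}) : (size p <= size r)%N ->
    p.[z] / D.[z] = \sum_(w <- r) (z - w)^-1 * ((lc * e w)^-1 * p.[w]).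
  move=> sp; rewrite Dz invfM mulrCA (partial_fractions ur sp zr) mulr_sumr.
  by apply: eq_bigr => w _; rewrite -/(e w) invfM; ring.
split; apply/matrixP => i j; rewrite entry summxE.
  rewrite -mulrA [_^-1 * _]mulrC fractions// mulr_sumr.
  by apply: eq_bigr => w _; rewrite !mxE /= horner_evalE -mulrA.
have := fractions _ (szXadj i j); rewrite hornerM hornerX mulrAC => ->.
apply: eq_bigr => w _; rewrite !mxE /= horner_evalE hornerM hornerX.
by rewrite [w / _]mulrC -mulrA; congr (_ * _); rewrite mulrCA.
Qed.

End ResolventPoly.

(** * Sesquilinear forms and positive definite matrices *)

Section Hermitian.
Variable R : realType.
Local Notation C := R[i].
Local Open Scope sesquilinear_scope.

(** Polarised version of [qform], to which it is convertible for x = y; off-diagonal blocks require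
    two different arguments. *)
Definition bform m n (M : 'M[C]_(m, n)) (x : 'cV[C]_m) (y : 'cV[C]_n) : C :=
  (x^t* *m M *m y) 0 0.

Lemma adjmxM m n p (M : 'M[C]_(m, n)) (N : 'M[C]_(n, p)) :
  (M *m N)^t* = N^t* *m M^t*.
Proof. by rewrite trmx_mul map_mxM. Qed.

Lemma hermsymmxP n (M : 'M[C]_n) : M \is hermsymmx <-> M^t* = M.
Proof.
split=> [/is_hermitianmxP {2}->|H]; first by rewrite expr0 scale1r.
by apply/is_hermitianmxP; rewrite expr0 scale1r H.
Qed.

Lemma bformE m n (M : 'M[C]_(m, n)) x y :
  bform M x y = \sum_i \sum_j (x i 0)^*%C * M i j * y j 0.
Proof.
rewrite /bform mxE exchange_big; apply: eq_bigr => j _.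
by rewrite mxE mulr_suml; apply: eq_bigr => i _; rewrite !mxE.
Qed.

Lemma bformDl m n (M N : 'M[C]_(m, n)) x y :
  bform (M + N) x y = bform M x y + bform N x y.
Proof. by rewrite /bform mulmxDr mulmxDl mxE. Qed.

Lemma bformZ m n a (M : 'M[C]_(m, n)) x y :
  bform (a *: M) x y = a * bform M x y.
Proof. by rewrite /bform -scalemxAr -scalemxAl mxE. Qed.

Lemma bformZl m n (M : 'M[C]_(m, n)) a x y :
  bform M (a *: x) y = a^*%C * bform M x y.
Proof. by rewrite /bform linearZ map_mxZ -!scalemxAl mxE. Qed.

Lemma bformZr m n (M : 'M[C]_(m, n)) a x y :
  bform M x (a *: y) = a * bform M x y.
Proof. by rewrite /bform -scalemxAr mxE. Qed.

Lemma bform0 m n x y : bform (0 : 'M[C]_(m, n)) x y = 0.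
Proof. by rewrite /bform mulmx0 mul0mx mxE. Qed.

Lemma hpdmx_unit n (M : 'M[C]_n) : hpdmx M -> M \in unitmx.
Proof.
move=> [_ Mpos]; rewrite unitmxE unitfE; apply/negP; rewrite -det_tr => /det0P[v v0 vM].
have := Mpos v^T; rewrite trmx_eq0 => /(_ v0); rewrite /qform -mulmxA.
by rewrite -[M]trmxK -trmx_mul vM trmx0 mulmx0 mxE ltxx.
Qed.

(** The form of the inverse at x is the form of M at M^-1 x. *)
Lemma hpdmx_inv n (M : 'M[C]_n) : hpdmx M -> hpdmx (invmx M).
Proof.
move=> hM; have uM := hpdmx_unit hM; case: hM => /hermsymmxP hM Mpos.
have hV : (invmx M)^t* = invmx M by rewrite trmx_inv map_invmx hM.
split=> [|x x0]; first exact/hermsymmxP.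
have <- : qform M (invmx M *m x) = qform (invmx M) x.
  by rewrite /qform adjmxM hV -!mulmxA mulKVmx.
apply: Mpos; apply: contraNneq x0 => /(congr1 (mulmx M)).
by rewrite mulKVmx// mulmx0 => ->.
Qed.

Lemma qform_mxblock p n (B : 'I_p -> 'I_p -> 'M[C]_n) (y : 'I_p -> 'cV[C]_n) :
  qform (\mxblock_(k < p, l < p) B k l) (\mxcol_(k < p) y k) =
  \sum_k \sum_l bform (B k l) (y k) (y l).
Proof.
rewrite /qform; have -> : (\mxcol_(k < p) y k)^t* = \mxrow_(k < p) (y k)^t*.
  by apply/matrixP => i j; rewrite !mxE.
rewrite mul_mxrow_mxblock mul_mxrow_mxcol summxE exchange_big.
by apply: eq_bigr => l _; rewrite mulmx_suml summxE.
Qed.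

End Hermitian.

(** * Positivity of Phi on the unit circle *)

Section PhiCircle.
Variables (R : realType) (d : nat) (A : 'M[R[i]]_(d + d)).
Local Notation C := R[i].
Local Open Scope sesquilinear_scope.
Hypothesis hpdA : hpdmx A.

Lemma A_blockE : A = block_mx (A_LL A) (A_LR A) (A_RL A) (A_RR A).
Proof. by rewrite submxK. Qed.

Lemma A_adj : [/\ (A_LL A)^t* = A_LL A, (A_LR A)^t* = A_RL A,
  (A_RL A)^t* = A_LR A & (A_RR A)^t* = A_RR A].
Proof.
have /hermsymmxP := hpdA.1; rewrite {1 2}A_blockE tr_block_mx map_block_mx.
by move/eq_block_mx => [-> -> -> ->].
Qed.

Lemma qformA_col_mx (x y : 'cV[C]_d) : qform A (col_mx x y) =
  bform (A_LL A) x x + bform (A_LR A) x y + (bform (A_RL A) y x + bform (A_RR A) y y).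
Proof.
rewrite /qform {1}A_blockE tr_col_mx map_row_mx mul_row_block mul_row_col.
have addE (M N : 'M[C]_1) : (M + N) 0 0 = M 0 0 + N 0 0 by rewrite mxE.
by rewrite !mulmxDl !addE addrACA.
Qed.

(** On the circle z^-1 is the conjugate of z, so the form of Phi(z) at x is the form of A at the
    stacked vector (x, z x). *)
Lemma hpd_Phi_circle (z : C) : `|z| = 1 -> hpdmx (Phi A z).
Proof.
move=> z1.
have z0 : z != 0 by rewrite -normr_eq0 z1 oner_eq0.
have zV : z^-1 = z^*%C by rewrite invc_norm z1 expr1n invr1 mul1r.
have zK : z^*%C * z = 1 by rewrite -zV mulVf.
have [aLL aLR aRL aRR] := A_adj; split.
  apply/hermsymmxP; rewrite /Phi zV !linearD !linearZ /= !map_mxD !map_mxZ /=.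
  rewrite aLL aLR aRL aRR /= (conjcK z : Num.conj z^*%C = z) -!addrA.
  by congr (_ + (_ + _)); rewrite addrC.
move=> x x0; have [_ /(_ (col_mx x (z *: x)))] := hpdA.
have -> : qform A (col_mx x (z *: x)) = qform (Phi A z) x.
  rewrite qformA_col_mx /Phi -[qform _ x]/(bform _ x x) !bformDl !bformZ zV.
  rewrite !bformZl !bformZr mulrA zK mul1r.
  by rewrite [X in _ = X + _]addrAC -[RHS]addrA; congr (_ + _); exact: addrC.
apply; apply: contraNneq x0 => /eqP; rewrite col_mx_eq0 => /andP[/eqP -> _].
by [].
Qed.

Lemma det_Phi_circle (z : C) : `|z| = 1 -> \det (Phi A z) != 0.
Proof. by move/hpd_Phi_circle/hpdmx_unit; rewrite unitmxE unitfE. Qed.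

Lemma spec_norm_neq1 (w : C) : spec A w -> `|w| != 1.
Proof. by move=> [_ dw]; apply/eqP => /det_Phi_circle; rewrite dw eqxx. Qed.

End PhiCircle.

(** * Fourier coefficients of 1 / (z - w) *)

Section CauchyKernel.
Variable R : realType.
Local Notation C := R[i].

(** The vanishing of these coefficients on a half-line comes from a recurrence and a uniform bound,
    without expanding a series under the integral. *)
Definition cauchy_coef (w : C) (k : int) : C :=
  circle_mean (fun t => expi (- (k%:~R * t)) / (expi t - w)).

Lemma ccont_expi1 : ccont (@expi R).
Proof. by have := @ccont_expi R 1; under eq_fun do rewrite mul1r. Qed.

Lemma ccont_expiN (k : int) : ccont (fun t : R => expi (- (k%:~R * t))).
Proof. by under eq_fun do rewrite -mulNr; exact: ccont_expi. Qed.

Lemma expi_sub_neq0 (w : C) t : `|w| != 1 -> expi t - w != 0.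
Proof. by move=> w1; rewrite subr_eq0; apply: contraNneq w1 => <-; rewrite norm_expi. Qed.

Lemma ccont_cauchy (w : C) : `|w| != 1 -> ccont (fun t => (expi t - w)^-1).
Proof.
move=> w1; apply: ccontV => [t|]; first exact: expi_sub_neq0.
by apply: ccontD; [exact: ccont_expi1 | exact: ccont_cst].
Qed.

(** Mean of z / (z - w) = w / (z - w) + 1 against z^-k: the factor z lowers the index by one, and
    the constant 1 contributes only at k = 0. *)
Lemma cauchy_coef_rec (w : C) (k : int) : `|w| != 1 ->
  cauchy_coef w (k - 1) = w * cauchy_coef w k + (k == 0)%:R.
Proof.
move=> w1; have cw := ccont_cauchy w1.
rewrite -circle_meanZ; last exact: ccontM (ccont_expiN _) cw.
have <- : circle_mean (fun t : R => expi (- (k%:~R * t))) = (k == 0)%:R :> C.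
  have [->|k0] := eqVneq k 0.
    rewrite -[RHS](circle_mean_expi0 R); apply: eq_circle_mean => t.
    by rewrite mul0r oppr0 expi0.
  have Nk0 : - k != 0 by rewrite oppr_eq0.
  rewrite -[RHS](circle_mean_expi R Nk0); apply: eq_circle_mean => t.
  by rewrite mulrNz mulNr.
rewrite -circle_meanD; last 2 first.
- exact: ccontM (ccont_cst _) (ccontM (ccont_expiN _) cw).
- exact: ccont_expiN.
apply: eq_circle_mean => t.
rewrite mulrzBr mulrBl mul1r opprB addrC expiD.
have := expi_sub_neq0 t w1; set e := expi t; set f := expi (- _) => ew.
by field.
Qed.

Lemma norm_complexE (z : C) : exists2 r : R, 0 <= r & `|z| = r%:C.
Proof. by rewrite normc_def; eexists; last reflexivity; exact: sqrtr_ge0. Qed.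

(** On the circle |z - w| is at least ||w| - 1|, which is positive; the bound is uniform in k. *)
Lemma cauchy_coef_bounded (w : C) : `|w| != 1 ->
  exists B : R, forall k, `|cauchy_coef w k| <= B%:C.
Proof.
move=> w1; have [r r0 wr] := norm_complexE w.
have r1 : r - 1 != 0 by rewrite subr_eq0; apply: contra_neq w1; rewrite wr => ->.
exists (2 * `|r - 1|^-1) => k.
apply: circle_mean_bound => [|t]; first exact: ccontM (ccont_expiN _) (ccont_cauchy w1).
have rN : `|r - 1|%:C <= `|expi t - w|.
  have := lerB_dist (expi t) w; have := lerB_dist w (expi t).
  rewrite [`|w - _|]distrC norm_expi wr; have [s _ ->] := norm_complexE (expi t - w).
  rewrite -!(rmorphB, rmorph1 (real_complex R)) !lecR ler_norml => -> ?.
  by rewrite andbT lerNl opprB.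
rewrite normrM norm_expi mul1r normfV fmorphV /= lef_pV2 ?posrE//.
  by rewrite normr_gt0 expi_sub_neq0.
by rewrite ltcR normr_gt0.
Qed.

(** The norms are moved to the reals, where |x| lies below a geometric sequence tending to 0. *)
Lemma geometric_eq0 (x q : C) (B : R) : `|q| < 1 ->
  (forall n, `|x| <= `|q| ^+ n * B%:C) -> x = 0.
Proof.
have [r r0 ->] := norm_complexE q; have [s s0 xs] := norm_complexE x.
rewrite ltcR => r1 H; apply/eqP; rewrite -normr_eq0 xs.
suff -> : s = 0 by [].
apply/le_anti; rewrite s0 andbT.
have r_lt1 : `|r| < 1 by rewrite ger0_norm.
have cg := cvg_geometric B r_lt1.
rewrite -(cvg_lim (@Rhausdorff R) cg); apply: limr_ge; first exact: cvgP cg.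
apply: nearW => n; rewrite /geometric /= -lecR mulrC rmorphM rmorphXn /=.
by have := H n; rewrite xs.
Qed.

(* Iterating the recurrence m times produces a factor w^m, while the
   coefficients stay bounded. *)
Lemma cauchy_coef_lt1 (w : C) (n : nat) : `|w| < 1 -> cauchy_coef w n = 0.
Proof.
move=> w1; have wn1 : `|w| != 1 by rewrite lt_eqF.
have [B HB] := cauchy_coef_bounded wn1.
apply: (geometric_eq0 (B := B) w1) => m.
have -> : cauchy_coef w n = w ^+ m * cauchy_coef w (n + m)%N.
  elim: m => [|m IH]; first by rewrite addn0 mul1r.
  rewrite IH exprSr -mulrA; congr (_ * _).
  have := cauchy_coef_rec (n + m.+1)%N wn1.
  have -> : (n + m.+1)%N%:Z - 1 = (n + m)%N%:Z by lia.
  have -> : ((n + m.+1)%N%:Z == 0) = false by lia.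
  by rewrite addr0.
by rewrite normrM normrX ler_wpM2l ?HB ?exprn_ge0 ?normr_ge0.
Qed.

(** The recurrence is run towards minus infinity, each step giving a factor w^-1. Starting at -1 or
    below keeps it away from the exceptional index 0. *)
Lemma cauchy_coef_gt1 (w : C) (n : nat) : 1 < `|w| -> cauchy_coef w (- n.+1%:Z) = 0.
Proof.
move=> w1; have wn1 : `|w| != 1 by rewrite gt_eqF.
have w0 : w != 0 by rewrite -normr_gt0 (lt_trans ltr01 w1).
have [B HB] := cauchy_coef_bounded wn1.
have wV1 : `|w^-1| < 1 by rewrite normfV invf_lt1 ?(lt_trans ltr01 w1).
apply: (geometric_eq0 (B := B) wV1) => m.
have -> : cauchy_coef w (- n.+1%:Z) = w^-1 ^+ m * cauchy_coef w (- (n + m).+1%:Z).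
  elim: m => [|m IH]; first by rewrite addn0 mul1r.
  rewrite IH exprSr -mulrA; congr (_ * _).
  have := cauchy_coef_rec (- (n + m).+1%:Z) wn1.
  have -> : - (n + m).+1%:Z - 1 = - (n + m.+1).+1%:Z by lia.
  have -> : (- (n + m).+1%:Z == 0) = false by lia.
  by rewrite addr0 => ->; rewrite mulKf.
by rewrite normrM normrX ler_wpM2l ?HB ?exprn_ge0 ?normr_ge0.
Qed.

End CauchyKernel.

Arguments ccont_expiN {R} k.

(** * The matrices C_k: shift relations, recurrence, positivity of the Toeplitz matrix *)

Section FourierCoefficients.
Variables (R : realType) (d : nat) (A : 'M[R[i]]_(d + d)).
Local Notation C := R[i].
Local Open Scope sesquilinear_scope.
Hypothesis hpdA : hpdmx A.
Hypothesis hI : assumptionI A.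
Hypothesis simple : forall w, spec A w -> mup w (detPhi_poly A) = 1%N.

Lemma det_LR_neq0 : \det (A_LR A) != 0.
Proof.
by rewrite -unitfE -unitmxE -row_free_unit /row_free hI.
Qed.

Lemma det_RL_neq0 : \det (A_RL A) != 0.
Proof.
have [_ <- _ _] := A_adj hpdA.
by rewrite det_map_mx det_tr fmorph_eq0 det_LR_neq0.
Qed.

(** Both decompositions are kept with the same [Rs]: their Fourier coefficients involve the same
    numbers at indices differing by one. *)
Definition circle_fractions (r : seq C) (Rs : C -> 'M[C]_d) : Prop :=
  (forall w, w \in r -> spec A w /\ Phi A w *m Rs w = 0) /\
  forall t : R,
    invmx (Phi A (expi t)) = \sum_(w <- r) (expi t / (expi t - w)) *: Rs w /\
    invmx (Phi A (expi t)) = \sum_(w <- r) (w / (expi t - w)) *: Rs w.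

Lemma circle_fractions_ex : exists r Rs, circle_fractions r Rs.
Proof.
have [r [Rs [rA fr]]] := invmx_Phi_fractions det_LR_neq0 det_RL_neq0 simple.
exists r, Rs; split=> // t; apply: fr; first exact: expi_neq0.
by apply: det_Phi_circle => //; exact: norm_expi.
Qed.

(** Continuity is read off the partial fractions, whose poles avoid the circle. *)
Lemma ccont_invPhi i j : ccont (fun t => invmx (Phi A (expi t)) i j).
Proof.
have [r [Rs [rA fr]]] := circle_fractions_ex.
rewrite (_ : (fun t => _) =
  fun t => \sum_(w <- r | w \in r) w * Rs w i j * (expi t - w)^-1).
  apply: ccont_sum => w /rA[/(spec_norm_neq1 hpdA) w1 _].
  exact: ccontM (ccont_cst _) (ccont_cauchy w1).
apply/funext => t; have [_ ->] := fr t; rewrite summxE big_seq.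
by apply: eq_bigr => w _; rewrite mxE mulrAC.
Qed.

(** In the sum with numerators z, the factor z shifts the index from k to k - 1. *)
Lemma coefC_fractions r Rs (k : int) : circle_fractions r Rs ->
  Defs.coefC A k = \sum_(w <- r) (w * cauchy_coef w k) *: Rs w /\
  Defs.coefC A k = \sum_(w <- r) cauchy_coef w (k - 1) *: Rs w.
Proof.
move=> [rA fr].
have cw w k' : w \in r -> ccont (fun t => expi (- (k'%:~R * t)) / (expi t - w)).
  move=> /rA[/(spec_norm_neq1 hpdA) w1 _].
  exact: ccontM (ccont_expiN _) (ccont_cauchy w1).
split; apply/matrixP => i j; rewrite mxE summxE big_seq.
  rewrite (eq_circle_mean (g := fun t => \sum_(w <- r | w \in r)
      w * Rs w i j * (expi (- (k%:~R * t)) / (expi t - w)))); last first.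
    move=> t; have [_ ->] := fr t; rewrite summxE mulr_suml big_seq.
    by apply: eq_bigr => w _; rewrite mxE; ring.
  rewrite circle_mean_sum => [|w /cw c]; last exact: ccontM (ccont_cst _) (c k).
  by apply: eq_bigr => w /cw c; rewrite circle_meanZ// mxE mulrAC.
rewrite (eq_circle_mean (g := fun t => \sum_(w <- r | w \in r)
    Rs w i j * (expi (- ((k - 1)%:~R * t)) / (expi t - w)))); last first.
  move=> t; have [-> _] := fr t; rewrite summxE mulr_suml big_seq.
  apply: eq_bigr => w _; rewrite mxE mulrzBr mulrBl mul1r opprB expiD.
  by ring.
rewrite circle_mean_sum => [|w /cw c]; last exact: ccontM (ccont_cst _) (c _).
by apply: eq_bigr => w /cw c; rewrite circle_meanZ// mxE mulrC.
Qed.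

(** Every column of N lies in the kernel of M, a line on which W acts as w. *)
Lemma mulmx_ker_eigen (M W N : 'M[C]_d) (v : 'cV[C]_d) (w : C) :
  spans_ker M v -> W *m v = w *: v -> M *m N = 0 -> W *m N = w *: N.
Proof.
move=> [_ kM] Wv MN; apply/trmx_inj/row_matrixP => j; rewrite -!tr_col; congr trmx.
have /kM[a cN] : M *m col j N = 0 by rewrite colE mulmxA MN mul0mx.
rewrite (_ : col j (W *m N) = W *m col j N); last by rewrite !colE mulmxA.
by rewrite linearZ /= cN -scalemxAr Wv !scalerA mulrC.
Qed.

Variable u : C -> 'cV[C]_d.
Hypothesis hu : forall w, spec A w -> spans_ker (Phi A w) (u w).

(** C_{n+1} and C_n are sums of c R_w and w c R_w with the same c = [cauchy_coef w n]. If |w| > 1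
    then W R_w = w R_w; if |w| < 1 then c = 0 because n >= 0. *)
Lemma mulmx_coefC_gt1 (W : 'M[C]_d) (n : nat) :
  (forall w, spec_gt1 A w -> W *m u w = w *: u w) ->
  W *m Defs.coefC A n.+1 = Defs.coefC A n.
Proof.
move=> hW; have [r [Rs rR]] := circle_fractions_ex.
have [_ ->] := coefC_fractions n.+1 rR; have [-> _] := coefC_fractions n rR.
have -> : n.+1%:Z - 1 = n by lia.
rewrite mulmx_sumr; apply: eq_big_seq => w /rR.1[sw Pw].
rewrite -scalemxAr mulrC -scalerA; have := spec_norm_neq1 hpdA sw.
rewrite real_neqr_lt ?normr_real ?real1//.
case/orP => w1; first by rewrite cauchy_coef_lt1// !scale0r.
by rewrite (mulmx_ker_eigen (hu sw) (hW _ _) Pw).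
Qed.

(** Mirror case: the common coefficient has index -n - 1 < 0 and vanishes for |w| > 1. *)
Lemma mulmx_coefC_lt1 (W : 'M[C]_d) (n : nat) :
  (forall w, spec_lt1 A w -> W *m u w = w *: u w) ->
  W *m Defs.coefC A (- n%:Z) = Defs.coefC A (- n%:Z - 1).
Proof.
move=> hW; have [r [Rs rR]] := circle_fractions_ex.
have [_ ->] := coefC_fractions (- n%:Z) rR.
have [-> _] := coefC_fractions (- n%:Z - 1) rR.
rewrite mulmx_sumr; apply: eq_big_seq => w /rR.1[sw Pw].
rewrite -scalemxAr mulrC -scalerA; have := spec_norm_neq1 hpdA sw.
rewrite real_neqr_lt ?normr_real ?real1//.
case/orP => w1; first by rewrite (mulmx_ker_eigen (hu sw) (hW _ _) Pw).
have -> : - n%:Z - 1 = - n.+1%:Z by lia.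
by rewrite cauchy_coef_gt1// !scale0r.
Qed.

(** This is the Fourier coefficient of index k of Phi Phi^-1 = I; the factors z and z^-1 shift the
    index to k - 1 and k + 1. *)
Lemma coefC_rec (k : int) :
  (A_LL A + A_RR A) *m Defs.coefC A k + A_LR A *m Defs.coefC A (k - 1)
    + A_RL A *m Defs.coefC A (k + 1) = ((k == 0)%:R)%:M.
Proof.
pose G t i j := invmx (Phi A (expi t)) i j.
have cG (n : int) i j : ccont (fun t => G t i j * expi (- (n%:~R * t))).
  by apply: ccontM; [exact: ccont_invPhi | exact: ccont_expiN].
have meanM (M : 'M[C]_d) (n : int) i j : (M *m Defs.coefC A n) i j =
    circle_mean (fun t => \sum_l M i l * (G t l j * expi (- (n%:~R * t)))).
  rewrite mxE circle_mean_sum => [|l _]; last exact: ccontM (ccont_cst _) (cG _ _ _).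
  by apply: eq_bigr => l _; rewrite mxE circle_meanZ.
have cM (M : 'M[C]_d) (n : int) i j :
    ccont (fun t => \sum_l M i l * (G t l j * expi (- (n%:~R * t)))).
  by apply: ccont_sum => l _; exact: ccontM (ccont_cst _) (cG _ _ _).
apply/matrixP => i j.
have addE (M N : 'M[C]_d) : (M + N) i j = M i j + N i j by rewrite mxE.
rewrite !addE !meanM -!circle_meanD//; last exact: ccontD.
rewrite (eq_circle_mean (g := fun t => (i == j)%:R * expi (- (k%:~R * t)))).
  rewrite circle_meanZ; last exact: ccont_expiN.
  rewrite mxE; have [->|k0] := eqVneq k 0.
    rewrite (eq_circle_mean (g := fun=> 1)) ?circle_mean_expi0 ?mulr1//.
    by move=> t; rewrite mul0r oppr0 expi0.
  rewrite (eq_circle_mean (g := fun t => expi ((- k)%:~R * t))).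
    by rewrite circle_mean_expi ?oppr_eq0// mulr0 mul0rn.
  by move=> t; rewrite mulrNz mulNr.
move=> t; set e := expi t; pose f := expi (- (k%:~R * t)).
have -> : expi (- ((k - 1)%:~R * t)) = e * f.
  by rewrite -expiD mulrzBr mulrBl mul1r opprB.
have -> : expi (- ((k + 1)%:~R * t)) = e^-1 * f.
  by rewrite -expiN -expiD mulrzDr mulrDl mul1r opprD addrC.
have uP : Phi A e \in unitmx by apply/hpdmx_unit/hpd_Phi_circle => //; exact: norm_expi.
have <- : (Phi A e *m invmx (Phi A e)) i j = (i == j)%:R by rewrite mulmxV// mxE.
rewrite mxE mulr_suml -!big_split; apply: eq_bigr => l _ /=.
by rewrite !mxE /G -/e -/f; ring.
Qed.

Lemma bform_coefC (n : int) (x y : 'cV[C]_d) : bform (Defs.coefC A n) x y =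
  circle_mean (fun t => expi (- (n%:~R * t)) * bform (invmx (Phi A (expi t))) x y).
Proof.
pose h i j t := (x i 0)^*%C * y j 0 * (invmx (Phi A (expi t)) i j * expi (- (n%:~R * t))).
have ch i j : ccont (h i j).
  exact: ccontM (ccont_cst _) (ccontM (ccont_invPhi _ _) (ccont_expiN _)).
rewrite (eq_circle_mean (g := fun t => \sum_i \sum_j h i j t)).
  rewrite circle_mean_sum => [|i _]; last exact: ccont_sum.
  rewrite bformE; apply: eq_bigr => i _; rewrite circle_mean_sum//.
  apply: eq_bigr => j _; rewrite /h circle_meanZ ?mxE 1?mulrAC//.
  exact: ccontM (ccont_invPhi _ _) (ccont_expiN _).
move=> t; rewrite bformE mulr_sumr; apply: eq_bigr => i _.
by rewrite mulr_sumr; apply: eq_bigr => j _; rewrite /h; ring.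
Qed.

Lemma ccont_bform (x y : 'cV[C]_d) :
  ccont (fun t => bform (invmx (Phi A (expi t))) x y).
Proof.
under eq_fun do rewrite bformE.
apply: ccont_sum => i _; apply: ccont_sum => j _.
exact: ccontM (ccontM (ccont_cst _) (ccont_invPhi _ _)) (ccont_cst _).
Qed.

Lemma coefC_adj (k : int) : (Defs.coefC A k)^t* = Defs.coefC A (- k).
Proof.
apply/matrixP => i j; rewrite !mxE -[Num.conj _]/((circle_mean _)^*%C).
rewrite -circle_mean_conj; last exact: ccontM (ccont_invPhi _ _) (ccont_expiN _).
have conjM (x y : C) : (x * y)^*%C = x^*%C * y^*%C by exact: rmorphM.
apply: eq_circle_mean => t; rewrite conjM expi_conj mulrNz mulNr; congr (_ * _).
have [/hermsymmxP H _] := hpdmx_inv (hpd_Phi_circle hpdA (norm_expi t)).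
by rewrite -[in RHS]H !mxE.
Qed.

Variable P : nat.

(** The exponential of -i(l - k)t splits into one factor for each argument of the sesquilinear
    form. *)
Lemma qform_toeplitz (y : 'I_P.+1 -> 'cV[C]_d) :
  qform (toeplitz_cov A P) (\mxcol_(k < P.+1) y k) =
  circle_mean (fun t => qform (invmx (Phi A (expi t)))
    (\sum_(l < P.+1) expi (- (l%:R * t)) *: y l)).
Proof.
rewrite qform_mxblock; set G := fun t => invmx (Phi A (expi t)).
rewrite [RHS](eq_circle_mean (g := fun t => \sum_(k < P.+1) \sum_(l < P.+1)
   expi (- ((l%:Z - k%:Z)%:~R * t)) * bform (G t) (y k) (y l))).
  have c (k l : 'I_P.+1) : ccont (fun t =>
      expi (- ((l%:Z - k%:Z)%:~R * t)) * bform (G t) (y k) (y l)).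
    by apply: ccontM; [exact: ccont_expiN | exact: ccont_bform].
  rewrite circle_mean_sum => [|k _]; last exact: ccont_sum.
  apply: eq_bigr => k _; rewrite circle_mean_sum//; apply: eq_bigr => l _.
  by rewrite bform_coefC.
move=> t; pose v (l : 'I_P.+1) := expi (- (l%:R * t)) *: y l.
have adj_sum : (\sum_l v l)^t* = \sum_l (v l)^t*.
  by rewrite [(\sum_l _)^T]raddf_sum map_mx_sum.
rewrite /qform -/(v _) adj_sum !mulmx_suml summxE.
apply: eq_bigr => k _; rewrite mulmx_sumr summxE; apply: eq_bigr => l _.
rewrite /v [X in map_mx _ X]linearZ /= map_mxZ /= -!scalemxAl -scalemxAr /bform.
have scaleE a (M : 'M[C]_1) : (a *: M) 0 0 = a * M 0 0 by rewrite mxE.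
rewrite !scaleE mulrA; congr (_ * _).
rewrite -[Num.conj _]/((expi _)^*%C) expi_conj -expiD; congr expi.
by rewrite opprK mulrzBr mulrBl -!pmulrn opprB addrC.
Qed.

(** For strictness, a zero mean of the form of Phi^-1 at p(t) makes p vanish almost everywhere, and
    the blocks y_m are Fourier coefficients of p. *)
Lemma hpd_toeplitz : hpdmx (toeplitz_cov A P).
Proof.
have hG t : hpdmx (invmx (Phi A (expi t))).
  by apply/hpdmx_inv/hpd_Phi_circle => //; exact: norm_expi.
split.
  apply/hermsymmxP/matrixP => a b; rewrite /toeplitz_cov [RHS]mxE.
  set k := tagnat.sig1 a; set l := tagnat.sig1 b.
  by rewrite -opprB -coefC_adj !mxE.
move=> x; rewrite -[x]submxcolK; set y := fun k => submxcol x k => x0.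
pose p t := \sum_(l < P.+1) expi (- (l%:R * t)) *: y l.
rewrite qform_toeplitz.
have q_ge0 t : 0 <= qform (invmx (Phi A (expi t))) (p t).
  have [->|p0] := eqVneq (p t) 0; last by have [_ /(_ _ p0)/ltW] := hG t.
  by rewrite /qform mulmx0 mxE.
have cp i : ccont (fun t => p t i 0).
  rewrite (_ : (fun t => _) = fun t => \sum_(l < P.+1) expi (- (l%:Z%:~R * t)) * y l i 0).
    by apply: ccont_sum => l _; exact: ccontM (ccont_expiN _) (ccont_cst _).
  by apply/funext => t; rewrite summxE; apply: eq_bigr => l _; rewrite mxE.
have cq : ccont (fun t => qform (invmx (Phi A (expi t))) (p t)).
  under eq_fun do rewrite -[qform _ _]/(bform _ _ _) bformE.
  apply: ccont_sum => i _; apply: ccont_sum => j _.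
  exact: ccontM (ccontM (ccont_conj (cp i)) (ccont_invPhi _ _)) (cp j).
rewrite lt_neqAle circle_mean_ge0// andbT.
apply: contraNneq x0 => /esym q0; apply/eqP.
rewrite (eq_mxcol (B_ := fun=> 0)) ?mxcol0// => m; apply/matrixP => i j.
rewrite ord1 [RHS]mxE.
(* The 0 on the right becomes the mean that extracts entry i of y_m from p by orthogonality. *)
rewrite -(circle_mean_eq0_support (g := fun t => p t i 0 * expi (m%:Z%:~R * t)) cq _ q_ge0 q0).
- rewrite (eq_circle_mean (g := fun t => \sum_(l < P.+1)
      y l i 0 * expi ((m%:Z - l%:Z)%:~R * t))); last first.
    move=> t; rewrite summxE mulr_suml; apply: eq_bigr => l _; rewrite mxE.
    by rewrite mulrzBr mulrBl [expi (_ - _)]expiD -!pmulrn; ring.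
  rewrite circle_mean_sum => [|l _]; last exact: ccontM (ccont_cst _) (ccont_expi _).
  rewrite (bigD1 m)//= big1 => [|l lm]; rewrite circle_meanZ; last exact: ccont_expi.
  + rewrite (eq_circle_mean (g := fun=> 1)) ?circle_mean_expi0 ?mulr1 ?addr0// => t.
    by rewrite subrr mul0r expi0.
  + exact: ccont_expi.
  + by rewrite circle_mean_expi ?mulr0// subr_eq0 eq_sym.
- exact: ccontM (cp i) (ccont_expi _).
- move=> t qt0; suff -> : p t = 0 by rewrite mxE mul0r.
  apply: contra_eq qt0 => p0; have [_ /(_ _ p0)] := hG t.
  by rewrite lt_def => /andP[].
Qed.

End FourierCoefficients.

(** For P = 0 the Toeplitz matrix is the single block C_0. Invertibility of C_0 later yields that of
    W_{>1}. *)
Lemma coefC0_unit (R : realType) (d : nat) (A : 'M[R[i]]_(d + d)) :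
  hpdmx A -> assumptionI A ->
  (forall w, spec A w -> mup w (detPhi_poly A) = 1%N) ->
  Defs.coefC A 0 \in unitmx.
Proof.
move=> hpdA hI simple; have [_ Spos] := hpd_toeplitz hpdA hI simple 0.
rewrite unitmxE unitfE; apply/negP; rewrite -det_tr => /det0P[v v0 vC].
pose x := \mxcol_(k < 1) v^T.
have x0 : x != 0.
  apply: contraNneq v0 => /(congr1 (fun M => submxcol M ord0)).
  by rewrite mxcolK submxcol0 -[v == 0]trmx_eq0 => ->.
suff q0 : qform (toeplitz_cov A 0) x = 0 by have := Spos _ x0; rewrite q0 ltxx.
rewrite qform_mxblock !big_ord1 subrr /bform -mulmxA.
by rewrite -[Defs.coefC A 0]trmxK -trmx_mul vC trmx0 mulmx0 mxE.
Qed.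

(** * The block tridiagonal matrix of the weight and its inverse *)

Section PrecisionMatrix.
Variables (R : realType) (d P : nat) (A : 'M[R[i]]_(d + d)) (BL BR : 'M[R[i]]_d).
Local Notation C := R[i].

(** Contributions to the diagonal block of site k from its left and from its right: a boundary
    matrix at an end of the path, otherwise a diagonal block of A from the adjacent edge. *)
Definition precision_left (k : nat) := if k == 0 then BL else A_RR A.
Definition precision_right (k : nat) := if k == P then BR else A_LL A.

Definition precision_block (k l : nat) : 'M[C]_d :=
  (if l == k then precision_left k + precision_right k else 0)
  + (if l == k.+1 then A_LR A else 0) + (if k == l.+1 then A_RL A else 0).

Definition precision : 'M[C]_(\sum_(k < P.+1) d) :=
  \mxblock_(k < P.+1, l < P.+1) precision_block k l.

(** The index k is a natural number that may be P + 1, the missing right neighbour of the last site.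
    [inord] is used only in range, so its default value never enters. *)
Lemma sum_ord_pick (V : nmodType) (k : nat) (F : 'I_P.+1 -> V) :
  \sum_(l < P.+1) (if l == k :> nat then F l else 0) =
  if (k < P.+1)%N then F (inord k) else 0.
Proof.
rewrite -big_mkcond; case: ltnP => kP.
  rewrite (big_pred1 (inord k))// => l.
  by apply/eqP/eqP => [<-|->]; rewrite ?inord_val ?inordK.
by rewrite big_pred0// => l; apply/negbTE; rewrite neq_ltn (leq_trans (ltn_ord l) kP).
Qed.

Lemma weightE (y : 'I_P.+1 -> 'cV[C]_d) :
  weight A BL BR y = qform precision (\mxcol_(k < P.+1) y k).
Proof.
have if_bform b (M : 'M[C]_d) x z :
    bform (if b then M else 0) x z = if b then bform M x z else 0.
  by case: b => //; rewrite bform0.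
rewrite qform_mxblock; under [RHS]eq_bigr => k _.
  under eq_bigr => l _ do rewrite !bformDl !if_bform.
  rewrite !big_split /= !sum_ord_pick ltn_ord inord_val.
  over.
(* The [A_RL] terms are summed over the row index first, since their condition [k == l.+1] selects k
   from l. *)
rewrite !big_split /= exchange_big /=.
under [X in _ + X]eq_bigr => l _ do rewrite sum_ord_pick.
have liftE (k : 'I_P) : lift ord0 k = inord k.+1.
  by apply/val_inj; rewrite /= inordK ?ltnS.
have widenE (k : 'I_P) : widen_ord (leqnSn P) k = inord k.
  by apply/val_inj; rewrite /= inordK // ltnS ltnW.
have sum_left : \sum_(k < P.+1) bform (precision_left k) (y k) (y k) =
    qform BL (y ord0) + \sum_(k < P) bform (A_RR A) (y (inord k.+1)) (y (inord k.+1)).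
  rewrite big_ord_recl; congr (_ + _); apply: eq_bigr => k _.
  by rewrite liftE /precision_left inordK ?ltnS.
have sum_right : \sum_(k < P.+1) bform (precision_right k) (y k) (y k) =
    \sum_(k < P) bform (A_LL A) (y (inord k)) (y (inord k)) + qform BR (y ord_max).
  rewrite big_ord_recr /= {2}/precision_right eqxx; congr (_ + _).
  apply: eq_bigr => k _.
  by rewrite widenE /precision_right (ltn_eqF (ltn_ord k)).
have sum_inner (F : 'I_P.+1 -> nat -> C) :
    \sum_(k < P.+1) (if (k.+1 < P.+1)%N then F k k.+1 else 0) =
    \sum_(k < P) F (inord k) k.+1.
  rewrite big_ord_recr /= ltnn addr0; apply: eq_bigr => k _.
  by rewrite ltnS ltn_ord widenE.
rewrite (sum_inner (fun k n => bform (A_LR A) (y k) (y (inord n)))).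
rewrite (sum_inner (fun k n => bform (A_RL A) (y (inord n)) (y k))).
under [in RHS]eq_bigr => k _ do rewrite bformDl.
rewrite big_split /= sum_left sum_right /weight.
under [in LHS]eq_bigr => k _ do rewrite qformA_col_mx.
by rewrite !big_split /=; ring.
Qed.

(** Inner rows reduce to the recurrence; in the first and last rows, the boundary identities supply
    the term of the missing neighbour. *)
Lemma precisionK (F : int -> 'M[C]_d) :
  (forall n : int, (A_LL A + A_RR A) *m F n + A_LR A *m F (n - 1)
    + A_RL A *m F (n + 1) = ((n == 0)%:R)%:M) ->
  (forall n : nat, BL *m F n = A_RR A *m F n + A_RL A *m F (n%:Z + 1)) ->
  (forall n : nat, BR *m F (- n%:Z) =
     A_LL A *m F (- n%:Z) + A_LR A *m F (- n%:Z - 1)) ->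
  precision *m (\mxblock_(k < P.+1, l < P.+1) F (l%:Z - k%:Z)) = 1%:M.
Proof.
move=> Frec FL FR; rewrite mul_mxblock.
rewrite -(mxdiagZ 1) /mxdiag; apply/eq_mxblockP => k l.
pose n := l%:Z - k%:Z.
(* At k = 0 the index n equals l >= 0, the range of the identity for [BL]. *)
have left_eq : precision_left k *m F n + (if (0 < k)%N then A_RL A *m F (n + 1) else 0)
    = A_RR A *m F n + A_RL A *m F (n + 1).
  rewrite /precision_left /n; case: posnP => [->|k0]; last by [].
  by rewrite subr0 addr0 FL.
(* At k = P the index n equals l - P <= 0, the range of the identity for [BR]. *)
have right_eq : precision_right k *m F n + (if (k < P)%N then A_LR A *m F (n - 1) else 0)
    = A_LL A *m F n + A_LR A *m F (n - 1).
  rewrite /precision_right; have [kP|kP] := eqVneq (k : nat) P.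
    rewrite kP ltnn addr0; have -> : n = - (P - l)%N%:Z.
      by rewrite /n kP -opprB subzn// -ltnS.
    by rewrite FR.
  by rewrite ltn_neqAle kP -ltnS ltn_ord.
transitivity (precision_left k *m F n + precision_right k *m F n
  + (if (k < P)%N then A_LR A *m F (n - 1) else 0)
  + (if (0 < k)%N then A_RL A *m F (n + 1) else 0)).
  have if_mul b (M N : 'M[C]_d) : (if b then M else 0) *m N = if b then M *m N else 0.
    by case: b => //; rewrite mul0mx.
  under eq_bigr => m _ do rewrite !mulmxDl !if_mul.
  rewrite !big_split /= !sum_ord_pick ltn_ord ltnS inord_val -mulmxDl.
  congr (_ + _ + _).
    case: ifP => // kP; congr (_ *m F _).
    by rewrite inordK// /n intS opprD addrA addrAC.
  case: (posnP k) => [k0|k0]; first by rewrite k0 big1.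
  (* The condition [k == m.+1] is put in the form [m == k.-1], as [sum_ord_pick] requires. *)
  under eq_bigr => m _ do rewrite -(prednK k0) eqSS eq_sym.
  rewrite sum_ord_pick (leq_ltn_trans (leq_pred k))//; congr (_ *m F _).
  rewrite inordK ?(leq_ltn_trans (leq_pred k))// /n; lia.
have -> : k == l = (n == 0) by rewrite /n subr_eq0 eq_sym.
rewrite conform_mx_id -addrA [X in _ + X]addrC addrACA left_eq right_eq.
rewrite addrACA [A_RR A *m _ + _]addrC -mulmxDl [A_RL A *m _ + _]addrC addrA Frec.
by case: (n == 0); rewrite //= raddf0.
Qed.

End PrecisionMatrix.

(** * Identification of the covariance of the process *)

Theorem lemma5p6 (R : realType) (d P : nat) (d_gt0 : (0 < d)%N) (P_gt0 : (0 < P)%N)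
    (A : 'M[R[i]]_(d + d)) (hpdA : hpdmx A)
    (hI : assumptionI A) (hII : assumptionII A)
    (u : R[i] -> 'cV[R[i]]_d)
    (hu : forall w, spec A w -> spans_ker (Phi A w) (u w))
    (Wlt1 Wgt1 : 'M[R[i]]_d)
    (hWlt1 : forall w, spec_lt1 A w -> Wlt1 *m u w = w *: u w)
    (hWgt1 : forall w, spec_gt1 A w -> Wgt1 *m u w = w *: u w)
    (dO : measure_display) (Omega : measurableType dO) (Pr : probability Omega R)
    (X : {RV Pr >-> Cpath R P d})
    (hX : gaussian_markov_process X A (bcL A Wgt1) (bcR A Wlt1)) :
  centered_gaussian X (toeplitz_cov A P).
Proof.
have simple w : spec A w -> mup w (detPhi_poly A) = 1%N by case/hII.
have hS := hpd_toeplitz hpdA hI simple P.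
have Wgt1C := mulmx_coefC_gt1 hpdA hI simple hu _ hWgt1.
have Wlt1C := mulmx_coefC_lt1 hpdA hI simple hu _ hWlt1.
(* C_0 = W_{>1} C_1 is invertible, hence so is its left factor. *)
have Wgt1_unit : Wgt1 \in unitmx.
  by have := coefC0_unit hpdA hI simple; rewrite -(Wgt1C 0%N) unitmx_mul => /andP[].
pose Q := precision P A (bcL A Wgt1) (bcR A Wlt1).
have QS : Q *m toeplitz_cov A P = 1%:M.
  apply: precisionK => [|n|n]; first exact: coefC_rec.
    (* Replacing C_n by W_{>1} C_{n+1} cancels the inverse in [bcL]. *)
    by rewrite /bcL mulmxDl -(Wgt1C n) -mulmxA mulKmx// addrC -PoszD addn1 addrC.
  by rewrite /bcR mulmxDl -mulmxA Wlt1C.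
have QE : Q = invmx (toeplitz_cov A P).
  by rewrite -[LHS]mulmx1 -(mulmxV (hpdmx_unit hS)) mulmxA QS mul1mx.
exists Q; split.
- by rewrite QE; exact: hpdmx_inv.
- by rewrite QE invmxK.
- have -> : (fun x : Cpath R P d => qform Q (stack x)) =
      fun x => weight A (bcL A Wgt1) (bcR A Wlt1) (site x).
    by apply/funext => x; rewrite weightE.
  exact: hX.
Qed.
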